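(* Let $T^\sigma=(T,\sigma)$ be a signed tree, where $T$ is not a path, such that every special exterior major vertex $t_k$ of $T^\sigma$ satisfies $\mathrm{ter}(t_k)\neq 2$. Then $\dim(T^\sigma)=\dim(T)-|\eta(T^\sigma)|$, i.e. $\mathrm{mdd}(T^\sigma)=|\eta(T^\sigma)|$.
   Context: A signed graph $\Sigma=(G,\sigma)$ consists of a finite simple connected graph $G=(V,E)$ and a signature $\sigma:E\to\{+1,-1\}$. In a signed tree every pair of vertices $u,v$ is joined by a unique path $P(u,v)$, and the signed distance is $d_\Sigma(u,v)=\sigma(P(u,v))\,d(u,v)$, where $d$ is the usual distance and $\sigma(P)$ is the product of edge signs of $P$. For an ordered subset $W=(w_1,\dots,w_k)$ of vertices, $r_\Sigma(v|W)=(d_\Sigma(v,w_1),\dots,d_\Sigma(v,w_k))$; $W$ is a resolving set if distinct vertices have distinct representations; $\dim(T^\sigma)$ is the minimum size of a resolving set, and $\dim(T)$ is defined analogously for the unsigned tree using $d$. The metric dimensional difference is $\mathrm{mdd}(T^\sigma)=\dim(T)-\dim(T^\sigma)$. Tree terminology: a leaf is a vertex of degree $1$; a major vertex is a vertex of degree at least $3$; a leaf $u$ is a terminal vertex of a major vertex $v$ if $d(u,v)<d(u,w)$ for every other major vertex $w$; the terminal degree $\mathrm{ter}(v)$ is the number of terminal vertices of $v$; an exterior major vertex is a major vertex with positive terminal degree. A leg of an exterior major vertex $t_k$ is the path from $t_k$ to one of its terminal vertices; $L_{k,j}$ is the set of vertices (other than $t_k$) on the $j$-th leg of $t_k$, and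 a vertex $u\in L_{k,j}$ has index $i$ if $d(t_k,u)=i$. An exterior major vertex $t_k$ is special if there are two distinct legs $L_{k,n}$, $L_{k,m}$ of $t_k$ such that for every index $i$, whenever $u_i\in L_{k,n}$ and $v_i\in L_{k,m}$ both have index $i$, one has $d_\Sigma(t_k,u_i)\neq d_\Sigma(t_k,v_i)$ (i.e. the paths from $t_k$ to $u_i$ and to $v_i$ have opposite signs). $\eta(T^\sigma)$ denotes the set of special exterior major vertices. *)

(* Defs.v *)
From mathcomp Require Import all_boot all_order all_algebra.
Set Implicit Arguments. Unset Strict Implicit. Unset Printing Implicit Defensive.
Import Order.TTheory GRing.Theory Num.Theory.

Section SignedTree.
Variable V : finType.
Variable e : rel V.
Variable sigma : V -> V -> int.

Definition simple_graph : Prop := symmetric e /\ irreflexive e.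
Definition connected_graph : Prop := forall u v : V, connect e u v.
Definition acyclic_graph : Prop :=
  forall p : seq V, uniq p -> 2 < size p -> ~~ cycle e p.
Definition is_tree : Prop := [/\ simple_graph, connected_graph & acyclic_graph].

Definition is_signature : Prop :=
  forall u v, e u v -> sigma u v = sigma v u /\ (sigma u v = 1 \/ sigma u v = -1)%R.

Definition is_path_graph : Prop :=
  exists s : seq V, [/\ uniq s, (forall x, x \in s) &
    forall x y, e x y = ((x, y) \in zip s (behead s)) || ((y, x) \in zip s (behead s))].

Fixpoint walk (n : nat) (u v : V) : bool :=
  if n is n'.+1 then [exists w, e u w && walk n' w v] else u == v.
(* usual distance (length of a shortest walk; for connected graphs < #|V|) *)
Definition dist (u v : V) : nat := find (fun n => walk n u v) (iota 0 #|V|).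

Definition neg_edge (u v : V) : bool := sigma u v == (-1)%R.
Fixpoint swalk (n : nat) (u v : V) (b : bool) : bool :=
  if n is n'.+1 then [exists w, e u w && swalk n' w v (b (+) neg_edge u w)]
  else (u == v) && ~~ b.
(* sign of the (unique, i.e. shortest) path P(u,v) in the tree *)
Definition path_sign (u v : V) : int :=
  if swalk (dist u v) u v false then 1%R else (-1)%R.
Definition sdist (u v : V) : int := (path_sign u v * (dist u v)%:Z)%R.
Definition udist (u v : V) : int := (dist u v)%:Z.

Definition resolving (d : V -> V -> int) (W : {set V}) : bool :=
  [forall x, forall y, [forall w in W, d x w == d y w] ==> (x == y)].
Definition metric_dim (d : V -> V -> int) : nat :=
  \big[minn/#|V|]_(W : {set V} | resolving d W) #|W|.
Definition dimT : nat := metric_dim udist.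
Definition dimS : nat := metric_dim sdist.
Definition mdd : int := (dimT%:Z - dimS%:Z)%R.

Definition deg (v : V) : nat := #|[set w | e v w]|.
Definition leaf (v : V) : bool := deg v == 1.
Definition major (v : V) : bool := 3 <= deg v.
Definition terminal (t u : V) : bool :=
  [&& major t, leaf u &
      [forall w, (major w && (w != t)) ==> (dist u t < dist u w)]].
Definition ter (t : V) : nat := #|[set u | terminal t u]|.
Definition exterior_major (t : V) : bool := major t && (0 < ter t).
Definition on_leg (t u x : V) : bool :=
  (x != t) && (dist t x + dist x u == dist t u).
Definition special (t : V) : bool :=
  exterior_major t &&
  [exists u1, exists u2,
    [&& terminal t u1, terminal t u2, u1 != u2 &
      [forall x, forall y,
        [&& on_leg t u1 x, on_leg t u2 y & dist t x == dist t y] ==>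
        (sdist t x != sdist t y)]]].
Definition eta : {set V} := [set t | special t].

End SignedTree.

(* Main.v *)
(** For every signature, the metric dimension plus the number of special vertices equals the sum of [ter t - 1] over the vertices [t] with [ter t > 0]; the unsigned case is the constant signature 1.
    Lower bound: if two legs at [t] avoid a resolving set, all distances from them to it factor through [t], so these legs must show opposite signs at every index; hence at most one leg at [t] is avoided, two if [t] is special.
    Upper bound: take all terminal vertices except one at each exterior major vertex, resp. the two witnessing legs at a special one. If [x] and [y] are not resolved, the midpoint [m] of their path is major and the branches at [m] towards them avoid the set. A branch containing a major vertex contains all the legs of a major vertex of terminal degree at least 2, whose terminal vertices are not all omitted because special vertices have terminal degree at least 3. So both branches are omitted legs of [m], which is therefore special, and the signs tell [x] and [y] apart. *)

Require Import Defs.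
From mathcomp Require Import all_boot all_order all_algebra.
From mathcomp Require Import zify.
Import GRing.Theory.

Section Tree.

Set Implicit Arguments.
Unset Strict Implicit.
Unset Printing Implicit Defensive.

Variables (V : finType) (e : rel V).
Hypothesis Htree : is_tree e.

Local Notation d := (dist e).

(** * Walks and the usual distance *)

Lemma edge_sym : symmetric e.
Proof. by case: Htree => -[]. Qed.

Lemma edge_irr : irreflexive e.
Proof. by case: Htree => -[]. Qed.

Lemma walk_cat m n u v w : walk e m u v -> walk e n v w -> walk e (m + n) u w.
Proof.
elim: m u => [|m IHm] u /=; first by move/eqP->.
case/existsP=> z /andP[euz zv] vw.
by apply/existsP; exists z; rewrite euz (IHm z).
Qed.

Lemma walk1 u v : e u v -> walk e 1 u v.
Proof. by move=> uv; apply/existsP; exists v; rewrite uv /=. Qed.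

Lemma walk_sym n u v : walk e n u v -> walk e n v u.
Proof.
elim: n u => [|n IHn] u /=; first by rewrite eq_sym.
case/existsP=> z /andP[euz /IHn vz].
have zu : e z u by rewrite edge_sym.
by have := walk_cat vz (walk1 zu); rewrite addn1.
Qed.

Lemma path_walk p u : path e u p -> walk e (size p) u (last u p).
Proof.
elim: p u => [|x p IHp] u //= /andP[ux /IHp xp].
by apply/existsP; exists x; rewrite ux.
Qed.

(** [dist] searches only lengths below [#|V|]; shortening a connecting path to a duplicate-free one
    makes this search succeed. *)
Lemma has_walk u v : has (fun n => walk e n u v) (iota 0 #|V|).
Proof.
have [_ conn _] := Htree; case/connectP: (conn u v) => p ep ->.
case/shortenP: ep => q eq uq _; apply/hasP; exists (size q); last exact: path_walk.
rewrite mem_iota /= add0n; apply: leq_trans (max_card (mem (u :: q))).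
by rewrite (card_uniqP uq).
Qed.

Lemma dist_lt_card u v : d u v < #|V|.
Proof. by have := has_walk u v; rewrite has_find size_iota. Qed.

Lemma walk_dist u v : walk e (d u v) u v.
Proof.
have := nth_find 0 (has_walk u v).
by rewrite nth_iota ?dist_lt_card.
Qed.

Lemma dist_le_walk n u v : walk e n u v -> d u v <= n.
Proof.
move=> uv; rewrite leqNgt; apply/negP=> lt_n.
have := before_find 0 lt_n; rewrite nth_iota ?add0n ?uv //.
exact: ltn_trans lt_n (dist_lt_card u v).
Qed.

Lemma dist_eq0 u v : (d u v == 0) = (u == v).
Proof.
apply/eqP/eqP => [d0|->]; first by have := walk_dist u v; rewrite d0 => /eqP.
by apply/eqP; rewrite -leqn0; apply: dist_le_walk => /=.
Qed.

Lemma dist_xx u : d u u = 0.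
Proof. by apply/eqP; rewrite dist_eq0. Qed.

Lemma dist_sym u v : d u v = d v u.
Proof.
by apply/eqP; rewrite eqn_leq !dist_le_walk //; apply: walk_sym; apply: walk_dist.
Qed.

Lemma dist_triangle v u w : d u w <= d u v + d v w.
Proof. by apply/dist_le_walk/(walk_cat (walk_dist u v))/walk_dist. Qed.

Lemma dist_edge u w : e u w -> d u w = 1.
Proof.
move=> uw; apply/eqP; rewrite eqn_leq (dist_le_walk (walk1 uw)) lt0n dist_eq0.
by apply: contraTneq uw => ->; rewrite edge_irr.
Qed.

(** * Geodesics, parity and midpoints in a tree *)

Lemma dist_step u v n : d u v = n.+1 -> exists2 w, e u w & d w v = n.
Proof.
move=> dn; have := walk_dist u v; rewrite dn => /existsP[w /andP[uw /dist_le_walk le_n]].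
by exists w => //; have := dist_triangle w u v; rewrite (dist_edge uw); lia.
Qed.

(* Two such neighbours are joined through [v] by geodesics avoiding [u], which would close a cycle through [u]. *)
Lemma closer_neighbor_uniq u v w1 w2 :
  e u w1 -> e u w2 -> d w1 v <= d u v -> d w2 v <= d u v -> w1 = w2.
Proof.
have [_ _ acyc] := Htree.
pose e' := [rel x y | [&& e x y, x != u & y != u]].
have e'_sym : connect_sym e'.
  by apply: sym_connect_sym => x y /=; rewrite edge_sym [(x != u) && _]andbC.
have toV w : e u w -> d w v <= d u v -> connect e' w v.
  move=> uw; have : w != u by apply: contraTneq uw => ->; rewrite edge_irr.
  have [n] := ubnP (d w v); elim: n w {uw} => // n IHn w lt_n wu le_d.
  case dw: (d w v) => [|k]; first by have /eqP := dw; rewrite dist_eq0 => /eqP->.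
  have [z wz dz] := dist_step dw.
  have zu : z != u by apply/eqP=> zu; move: le_d; rewrite dw -zu; lia.
  have wz' : e' w z by rewrite /= wz wu zu.
  by apply: (@connect_trans _ e' z); [apply: connect1 | apply: IHn => //; lia].
move=> uw1 uw2 le1 le2; apply/eqP; apply/negPn/negP => neq.
have : connect e' w1 w2.
  by apply: (@connect_trans _ e' v); rewrite ?(e'_sym v) toV.
case/connectP=> p ep; case/shortenP: ep => q eq uq _ lastq.
have w1u : w1 != u by apply: contraTneq uw1 => ->; rewrite edge_irr.
have uNq : u \notin w1 :: q.
  rewrite inE negb_or eq_sym w1u /=; apply/negP => uq'.
  by case/splitPr: uq' eq => q1 q2; rewrite cat_path /= eqxx !andbF.
have eq_e : path e w1 q by apply: sub_path eq => x y /andP[].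
have sz : 2 < size (u :: w1 :: q).
  by case: (q) lastq neq => //= ->; rewrite eqxx.
have := acyc _ _ sz; rewrite cons_uniq uNq uq => /(_ isT) /negP; apply.
by rewrite /cycle rcons_path /= uw1 eq_e -lastq edge_sym.
Qed.

(** Trees are bipartite. If the two distances agreed, [w] and the next vertex from [u] towards [v]
    would both be no farther from [v] than [u], hence equal, although the latter is strictly
    closer. *)
Lemma dist_edge_neq u w v : e u w -> d u v = (d w v).+1 \/ d w v = (d u v).+1.
Proof.
move=> uw; have le1 := dist_triangle w u v; have le2 := dist_triangle u w v.
rewrite (dist_edge uw) in le1; rewrite [d w u]dist_sym (dist_edge uw) in le2.
case: (ltngtP (d u v) (d w v)) => [||eqd]; [lia|lia|].
case du: (d u v) => [|n].
  have wv : w = v by apply/eqP; rewrite -dist_eq0 -eqd du.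
  by move/eqP: du; rewrite dist_eq0 -wv => /eqP uw'; move: uw; rewrite uw' edge_irr.
have [z uz dz] := dist_step du.
have wz : w = z by apply: (@closer_neighbor_uniq u v) => //; lia.
by move: eqd; rewrite wz; lia.
Qed.

(** Every step from [x] towards [y] changes the distance to [w] by exactly one. *)
Lemma odd_dist x y w : odd (d x y) = odd (d x w) (+) odd (d y w).
Proof.
case dn: (d x y) => [|n].
  by move/eqP: dn; rewrite dist_eq0 => /eqP->; rewrite addbb.
elim: n x dn => [|n IHn] x dn; have [z xz dz] := dist_step dn.
  move/eqP: dz; rewrite dist_eq0 => /eqP zy; rewrite -zy.
  by case: (dist_edge_neq w xz) => -> /=; rewrite ?addNb ?addbN addbb.
have /= -> := IHn z dz; case: (dist_edge_neq w xz) => -> /=;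
  by rewrite addNb ?negbK.
Qed.

Lemma dist_between x y k : k <= d x y ->
  exists m, d x m = k /\ d m y = d x y - k.
Proof.
elim: k => [|k IHk] le_k; first by exists x; rewrite dist_xx subn0.
have [|m [xm my]] := IHk; first by lia.
have [|z mz zy] := @dist_step m y (d x y - k.+1); first by lia.
exists z; split=> //.
by have := dist_triangle m x z; have := dist_triangle z x y; rewrite (dist_edge mz); lia.
Qed.

(** * Branches at a vertex *)

(* The branch at [m] through its neighbour [a]: the component of [a] in the tree with [m] removed. *)
Definition branch (m a x : V) : bool := d x a < d x m.

Lemma branchE m a x : e m a -> branch m a x -> d x m = (d x a).+1.
Proof. by move=> /(dist_edge_neq x); rewrite /branch (dist_sym x a) (dist_sym x m); lia. Qed.

Lemma branchN m a x : e m a -> ~~ branch m a x -> d x a = (d x m).+1.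
Proof. by move=> /(dist_edge_neq x); rewrite /branch (dist_sym x a) (dist_sym x m); lia. Qed.

Lemma branch_root m a : e m a -> branch m a a.
Proof. by move=> ma; rewrite /branch dist_xx dist_sym dist_edge. Qed.

Lemma branch_neq m a x : branch m a x -> x != m.
Proof. by apply: contraTneq => ->; rewrite /branch dist_xx. Qed.

(** If [x] were not [a], then [y] and the next vertex from [x] towards [a] would both be neighbours
    of [x] closer to [m], hence equal, but their distances to [a] differ. *)
Lemma edge_leave_branch m a x y :
  e m a -> e x y -> branch m a x -> ~~ branch m a y -> x = a /\ y = m.
Proof.
move=> ma xy /(branchE ma) bx /(branchN ma) by_.
have Em := dist_edge_neq m xy; have Ea := dist_edge_neq a xy.
have xa : x = a.
  case dx: (d x a) => [|n]; first by apply/eqP; rewrite -dist_eq0 dx.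
  have [z xz dz] := dist_step dx.
  have zm := dist_triangle a z m; rewrite [d a m]dist_sym (dist_edge ma) in zm.
  have yz : y = z by apply: (@closer_neighbor_uniq x m) => //; lia.
  by subst y; lia.
split=> //; apply/eqP; rewrite -dist_eq0.
by move: bx Em Ea; rewrite xa dist_xx; lia.
Qed.

(** A geodesic from [x] to [y] must leave the branch, and its only exit is the edge from [a] to
    [m]. *)
Lemma dist_through m a x y :
  e m a -> branch m a x -> ~~ branch m a y -> d x y = d x m + d m y.
Proof.
move=> ma; case dn: (d x y) => [|n].
  by move/eqP: dn; rewrite dist_eq0 => /eqP-> ->.
elim: n x dn => [|n IHn] x dn bx nby; have [z xz dz] := dist_step dn;
  have := dist_triangle m x y; rewrite dn; have [bz|nbz] := boolP (branch m a z).
- by move/eqP: dz; rewrite dist_eq0 => /eqP zy; move: nby; rewrite -zy bz.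
- by have [_ zm] := edge_leave_branch ma xz bx nbz; rewrite -zm (dist_edge xz) dz.
- have := IHn z dz bz nby; have := dist_triangle z x m.
  by rewrite (dist_edge xz); lia.
by have [_ zm] := edge_leave_branch ma xz bx nbz; rewrite -zm (dist_edge xz) dz.
Qed.

Lemma ex_branch m x : x != m -> exists2 a, e m a & branch m a x.
Proof.
rewrite eq_sym -dist_eq0 /branch; case dn: (d m x) => [//|n] _.
have [a ma da] := dist_step dn; exists a => //.
by rewrite (dist_sym x a) (dist_sym x m); lia.
Qed.

Lemma branch_uniq m a b x : e m a -> e m b -> branch m a x -> branch m b x -> a = b.
Proof.
move=> ma mb; rewrite /branch !(dist_sym x) => ltA ltB.
by apply: (@closer_neighbor_uniq m x) => //; apply: ltnW.
Qed.

(** Otherwise [m] would lie between [t] and [x], and [t] between [x] and [m], forcing [t] and [m] to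
    coincide. *)
Lemma branch_sub m a t c x : e m a -> e t c -> branch m a t -> ~~ branch t c m ->
  branch t c x -> branch m a x.
Proof.
move=> ma tc bt ncm bx; apply/negPn/negP => nbx.
have := dist_through ma bt nbx; have := dist_through tc bx ncm.
have := branch_neq bt; rewrite -dist_eq0 [d x t]dist_sym [d x m]dist_sym; lia.
Qed.

(** * Major vertices, terminal vertices and legs *)

Lemma major3 z a b c : e z a -> e z b -> e z c -> a != b -> a != c -> b != c ->
  major e z.
Proof.
move=> za zb zc ab ac bc; rewrite /major /deg.
have <- : #|[set a; b; c]| = 3.
  by rewrite setUC cardsU1 cards2 !inE negb_or ![c == _]eq_sym ab ac bc.
by apply/subset_leq_card/subsetP=> x; rewrite !inE -orbA => /or3P[]/eqP->.
Qed.

Lemma leaf_uniq u a b : leaf e u -> e u a -> e u b -> a = b.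
Proof.
move=> /cards1P[c Ec] ua ub.
have: a \in [set w | e u w] by rewrite inE.
have: b \in [set w | e u w] by rewrite inE.
by rewrite Ec !inE => /eqP-> /eqP->.
Qed.

Lemma leaf_not_major u : leaf e u -> ~~ major e u.
Proof. by rewrite /leaf /major => /eqP->. Qed.

Lemma terminal_major t u : terminal e t u -> major e t.
Proof. by case/and3P. Qed.

Lemma terminal_leaf t u : terminal e t u -> leaf e u.
Proof. by case/and3P. Qed.

Lemma terminal_dist t u w : terminal e t u -> major e w -> w != t -> d u t < d u w.
Proof. by case/and3P=> _ _ /forallP/(_ w)/implyP tu mw wt; apply: tu; rewrite mw. Qed.

Lemma terminal_neq t u : terminal e t u -> u != t.
Proof.
move=> tu; apply: contraTneq (terminal_major tu) => <-.
exact: leaf_not_major (terminal_leaf tu).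
Qed.

Lemma terminal_inj t t' u : terminal e t u -> terminal e t' u -> t = t'.
Proof.
move=> tu t'u; apply/eqP/negPn/negP => neq.
have := terminal_dist t'u (terminal_major tu) neq.
rewrite eq_sym in neq; have := terminal_dist tu (terminal_major t'u) neq; lia.
Qed.

(* The interior vertices of a leg have degree 2, so walking away from [t] along the branch never leaves the leg. *)
Lemma on_legE t u a x : terminal e t u -> e t a -> branch t a u ->
  on_leg e t u x = branch t a x.
Proof.
move=> tu ta bu; apply/idP/idP.
  case/andP=> xt /eqP dx; apply/negPn/negP=> nbx.
  have := dist_through ta bu nbx; rewrite (dist_sym u x) (dist_sym u t).
  by move: xt; rewrite eq_sym -dist_eq0; lia.
have nbr z y : z != t -> d t z + d z u = d t u -> e z y -> d t y + d y u = d t u.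
  move=> zt tz zy; case dtz: (d z t) => [|n].
    by move/eqP: dtz; rewrite dist_eq0 (negPf zt).
  have [p zp dp] := dist_step dtz.
  have pOK : d t p + d p u = d t u.
    have zp1 := dist_edge zp; have := dist_triangle p t u; have := dist_triangle z p u.
    by rewrite (dist_sym t p) (dist_sym p z) zp1; rewrite (dist_sym t z) in tz; lia.
  have [uz|zu] := eqVneq z u.
    by rewrite -uz in tu *; rewrite (leaf_uniq (terminal_leaf tu) zy zp) uz.
  case dzu: (d z u) => [|k]; first by move/eqP: dzu; rewrite dist_eq0 (negPf zu).
  have [q zq dq] := dist_step dzu.
  have qOK : d t q + d q u = d t u.
    have := dist_triangle q t u; have := dist_triangle z t q.
    by rewrite (dist_edge zq); lia.
  have [->//|yp] := eqVneq y p; have [->//|yq] := eqVneq y q.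
  have pq : p != q.
    by apply/eqP=> pq; subst q; move: pOK tz; rewrite (dist_sym t p) (dist_sym t z); lia.
  have mz := major3 zy zp zq yp yq pq.
  have := terminal_dist tu mz zt; rewrite (dist_sym u t) (dist_sym u z).
  by rewrite (dist_sym t z) in tz; lia.
move=> bx; rewrite /on_leg (branch_neq bx) /=; apply/eqP.
have [n] := ubnP (d x t); elim: n x bx => // n IHn x bx lt_n.
case dn: (d x a) => [|k].
  move/eqP: dn; rewrite dist_eq0 => /eqP->.
  by rewrite (dist_edge ta) (dist_sym t u) (branchE ta bu) (dist_sym a u); lia.
have [z xz dz] := dist_step dn.
have bz : branch t a z.
  apply/negPn/negP => nbz; have [xa _] := edge_leave_branch ta xz bx nbz.
  by move: dn; rewrite xa dist_xx.
apply: (nbr z); first exact: branch_neq bz.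
  apply: IHn => //; have := branchE ta bz; have := branchE ta bx; lia.
by rewrite edge_sym.
Qed.

Lemma terminal_branch_not_major t u a x : terminal e t u -> e t a ->
  branch t a u -> branch t a x -> ~~ major e x.
Proof.
move=> tu ta bu bx; apply/negP=> mx.
have := terminal_dist tu mx (branch_neq bx).
move: bx; rewrite -(on_legE x tu ta bu) => /andP[xt /eqP].
by move: xt; rewrite eq_sym -dist_eq0 (dist_sym x u) (dist_sym t u); lia.
Qed.

Lemma terminal_branch_inj t u v a : terminal e t u -> terminal e t v -> e t a ->
  branch t a u -> branch t a v -> u = v.
Proof.
move=> tu tv ta bu bv; apply/eqP; rewrite -dist_eq0.
have: on_leg e t u v by rewrite (on_legE v tu ta bu).
have: on_leg e t v u by rewrite (on_legE u tv ta bv).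
by case/andP=> _ /eqP E1 /andP[_ /eqP E2]; lia.
Qed.

(** A vertex of the branch farthest from [t] is a leaf, and all other major vertices lie outside the
    branch, hence beyond [t]. *)
Lemma branch_terminal t a : major e t -> e t a ->
  (forall x, branch t a x -> ~~ major e x) ->
  exists2 u, terminal e t u & branch t a u.
Proof.
move=> mt ta nomaj; case: (@arg_maxnP _ a (branch t a) (d t) (branch_root ta)) => u bu umax.
exists u => //; rewrite /terminal mt /=; apply/andP; split; last first.
  apply/forallP=> w; apply/implyP=> /andP[mw wt].
  have nbw : ~~ branch t a w by apply: contraL mw; apply: nomaj.
  by rewrite (dist_through ta bu nbw); move: wt; rewrite eq_sym -dist_eq0; lia.
case dn: (d u t) => [|n].
  by move/eqP: dn; rewrite dist_eq0 (negPf (branch_neq bu)).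
have [p up dp] := dist_step dn; apply/cards1P; exists p; apply/setP=> w; rewrite !inE.
apply/idP/eqP => [uw|-> //]; apply: (@closer_neighbor_uniq u t) => //; last by lia.
have [bw|nbw] := boolP (branch t a w).
  by have := umax w bw; rewrite (dist_sym t w) (dist_sym t u).
by have [_ ->] := edge_leave_branch ta uw bu nbw; rewrite dist_xx.
Qed.

(** Legs contain no major vertex, so each of [t] and [t'] lies outside the other's leg. Then [x]
    reaches [t'] through [t] and [t] through [t'], so both legs start at the same vertex and in the
    same branch. *)
Lemma on_leg_disjoint t t' u u' x : terminal e t u -> terminal e t' u' ->
  on_leg e t u x -> on_leg e t' u' x -> u = u'.
Proof.
move=> tu tu'; have [a ta bu] := ex_branch (terminal_neq tu).
have [a' ta' bu'] := ex_branch (terminal_neq tu').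
rewrite (on_legE x tu ta bu) (on_legE x tu' ta' bu') => bx bx'.
have tt' : t = t'.
  have nb : ~~ branch t a t'.
    by apply: contraL (terminal_major tu'); apply: terminal_branch_not_major tu ta bu.
  have nb' : ~~ branch t' a' t.
    by apply: contraL (terminal_major tu); apply: terminal_branch_not_major tu' ta' bu'.
  apply/eqP; rewrite -dist_eq0.
  by have := dist_through ta bx nb; have := dist_through ta' bx' nb'; lia.
subst t'; have aa' := branch_uniq ta ta' bx bx'; subst a'.
exact: terminal_branch_inj tu tu' ta bu bu'.
Qed.

Lemma dist_through_leg t u x w : terminal e t u -> on_leg e t u x -> ~~ on_leg e t u w ->
  d x w = d x t + d t w.
Proof.
move=> tu; have [a ta bu] := ex_branch (terminal_neq tu).
by rewrite !(on_legE _ tu ta bu); apply: dist_through.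
Qed.

(** * Finding vertices of terminal degree at least 2 *)

Lemma card_leg_branches t (D : {set V}) : major e t ->
  (forall c, c \in D -> e t c /\ forall x, branch t c x -> ~~ major e x) ->
  #|D| <= ter e t.
Proof.
move=> mt DP; pose toward u := odflt t [pick a | e t a && branch t a u].
apply: leq_trans (leq_imset_card toward _); apply/subset_leq_card/subsetP=> c cD.
have [tc nomaj] := DP c cD; have [u tu bu] := branch_terminal mt tc nomaj.
apply/imsetP; exists u; first by rewrite inE.
rewrite /toward; case: pickP => [a /andP[ta ba] | /(_ c)]; last by rewrite tc bu.
exact: branch_uniq tc ta bu ba.
Qed.

(** Take [t] as a major vertex of the branch farthest from [m]. Its branches away from [m] contain
    no major vertex, hence are legs, and degree at least 3 leaves at least two of them. *)
Lemma far_major m a r : e m a -> branch m a r -> major e r ->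
  exists2 t, branch m a t & 1 < ter e t.
Proof.
move=> ma br mr.
have r0 : branch m a r && major e r by rewrite br.
case: (@arg_maxnP _ r (fun x => branch m a x && major e x) (d m) r0) => t /andP[bt mt] tmax.
exists t => //; have [|p tp bp] := @ex_branch t m; first by rewrite eq_sym (branch_neq bt).
have : 1 < #|[set w | e t w] :\ p|.
  by have := mt; rewrite /major /deg (cardsD1 p) inE tp.
move/leq_trans; apply; apply: card_leg_branches => // c; rewrite !inE => /andP[cp tc].
split=> // x bx; apply/negP=> mx.
have ncm : ~~ branch t c m.
  by apply/negP=> bc; move: cp; rewrite (branch_uniq tc tp bc bp) eqxx.
have bmx := branch_sub ma tc bt ncm bx.
have := tmax x; rewrite bmx mx => /(_ isT); have := dist_through tc bx ncm.
by have := branch_neq bx; rewrite -dist_eq0 (dist_sym m x) (dist_sym m t); lia.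
Qed.

Lemma branch_ter m a t u : major e m -> e m a -> branch m a t -> terminal e t u ->
  branch m a u.
Proof.
move=> mm ma bt tu; have [c tc bu] := ex_branch (terminal_neq tu).
apply: (branch_sub ma tc bt _ bu).
by apply: contraL mm; apply: (terminal_branch_not_major tu tc bu).
Qed.

(** Either some branch at [r] contains another major vertex and [far_major] applies, or all branches
    at [r] are legs. *)
Lemma ex_ter_gt1 r : major e r -> exists t, 1 < ter e t.
Proof.
move=> mr; have [/existsP[r' /andP[mr' r'r]]|/existsPn nr] := boolP [exists r', major e r' && (r' != r)].
  have [a ra br] := ex_branch r'r.
  by have [t _ tt] := far_major ra br mr'; exists t.
exists r; apply: leq_trans (ltnW mr) _; apply: card_leg_branches => // c.
rewrite inE => rc; split=> // x /branch_neq xr.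
by have := nr x; rewrite xr andbT.
Qed.

(** * A tree without major vertices is a path *)

(** A vertex [u] farthest from [x0] has at most one neighbour. Distances from [u] are injective,
    since otherwise two vertices would branch off at a major vertex; listing all vertices by this
    distance gives the path. *)
Lemma no_major_path : (forall r, ~~ major e r) -> is_path_graph e.
Proof.
move=> nomaj; case: (pickP V) => [x0 _|V0]; last first.
  by exists [::]; split=> // x; have := V0 x.
case: (@arg_maxnP _ x0 xpredT (d x0) isT) => u _ umax.
have u1 a b : e u a -> e u b -> a = b.
  by move=> ua ub; apply: (@closer_neighbor_uniq u x0) => //;
     rewrite (dist_sym _ x0) (dist_sym u x0); apply: umax.
have inj x y : d u x = d u y -> x = y.
  have [n] := ubnP (d x u); elim: n x y => // n IHn x y lt_n Exy.
  rewrite !(dist_sym u) in Exy.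
  case dx: (d x u) => [|k].
    by move: (dx) (dx); rewrite {1}Exy => /eqP + /eqP; rewrite !dist_eq0 => /eqP-> /eqP->.
  have [p xp dp] := dist_step dx; rewrite Exy in dx; have [q yq dq] := dist_step dx.
  have pq : p = q by apply: IHn; rewrite ?(dist_sym u); lia.
  subst q; rewrite edge_sym in xp; rewrite edge_sym in yq.
  case: k => [|k] in dp dx dq.
    by move/eqP: dp; rewrite dist_eq0 => /eqP pu; apply: u1; rewrite -pu.
  have [r pr dr] := dist_step dp; apply/eqP/negPn/negP=> xy.
  have xr : x != r by apply/eqP=> xr; move: Exy; rewrite xr; lia.
  have yr : y != r by apply/eqP=> yr; move: dx; rewrite yr; lia.
  by have := nomaj p; rewrite (major3 xp yq pr xy xr yr).
(* [D] is an injection between sets of equal size, so every distance below [#|V|] occurs. *)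
pose D x : 'I_#|V| := Ordinal (dist_lt_card u x).
have injD : injective D by move=> x y /(congr1 val); apply: inj.
have [g Dg gD] : bijective D by apply: inj_card_bij => //; rewrite card_ord.
have Vgt0 : 0 < #|V| by apply/card_gt0P; exists x0.
pose f k := g (insubd (Ordinal Vgt0) k).
have df k : k < #|V| -> d u (f k) = k.
  by move=> lt_k; have := congr1 val (gD (insubd (Ordinal Vgt0) k)); rewrite val_insubd lt_k.
have fd x : f (d u x) = x by apply: inj; rewrite df // dist_lt_card.
pose s := mkseq f #|V|.
have szs : size s = #|V| by rewrite size_mkseq.
have zipP x y : ((x, y) \in zip s (behead s)) = (d u y == (d u x).+1).
  apply/idP/eqP=> [/(nthP (x0, x0))[i]|dy].
    rewrite size_zip size_behead szs => lt_i; rewrite nth_zip_cond size_zip size_behead szs lt_i.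
    have lt_i1 : i.+1 < #|V| by lia.
    have lt_i0 : i < #|V| by lia.
    rewrite nth_behead !nth_mkseq //.
    by case=> <- <-; rewrite !df.
  have ltx := dist_lt_card u x; have lty := dist_lt_card u y.
  apply/(nthP (x0, x0)); exists (d u x); first by rewrite size_zip size_behead szs; lia.
  rewrite nth_zip_cond size_zip size_behead szs.
  have -> : d u x < minn #|V| #|V|.-1 by lia.
  by rewrite /= nth_behead -dy !nth_mkseq // !fd.
exists s; split.
- rewrite map_inj_in_uniq ?iota_uniq // => i j; rewrite !mem_iota => lt_i lt_j Efg.
  by rewrite -(df i) // -(df j) // Efg.
- by move=> x; apply/mapP; exists (d u x); rewrite ?fd // mem_iota dist_lt_card.
move=> x y; rewrite !zipP; apply/idP/orP => [xy|[]/eqP dxy].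
- by have := dist_edge_neq u xy; rewrite !(dist_sym u) => -[]->; [right|left].
- move: dxy; rewrite dist_sym => /dist_step[z yz dz].
  by rewrite edge_sym -(inj z x) // dist_sym.
by move: dxy; rewrite dist_sym => /dist_step[z yz dz]; rewrite -(inj z y) // dist_sym.
Qed.

(** * Signs of paths and signed distances *)

Variable sigma : V -> V -> int.
Hypothesis Hsig : is_signature e sigma.

Local Notation neg := (neg_edge sigma).
Local Notation sd := (sdist e sigma).

Lemma neg_edge_sym u v : e u v -> neg u v = neg v u.
Proof. by move=> /Hsig[E _]; rewrite /neg_edge E. Qed.

Lemma swalk_walk n u v b : swalk e sigma n u v b -> walk e n u v.
Proof.
elim: n u b => [|n IHn] u b /=; first by case/andP.
by case/existsP=> w /andP[uw /IHn wv]; apply/existsP; exists w; rewrite uw.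
Qed.

Lemma swalk_step u w v b : e u w -> d u v = (d w v).+1 ->
  swalk e sigma (d u v) u v b = swalk e sigma (d w v) w v (b (+) neg u w).
Proof.
move=> uw dw; rewrite {1}dw /=; apply/existsP/idP=> [[z /andP[uz zv]]|wv]; last first.
  by exists w; rewrite uw.
have := dist_le_walk (swalk_walk zv) => le_z.
have zw : z = w by apply: (@closer_neighbor_uniq u v) => //; lia.
by subst z.
Qed.

(** The boolean carries the parity of the negative edges met so far; since the geodesic is unique,
    flipping it at the start flips the final test. *)
Lemma swalkN u v b :
  swalk e sigma (d u v) u v (~~ b) = ~~ swalk e sigma (d u v) u v b.
Proof.
case dn: (d u v) => [|n].
  by move/eqP: dn; rewrite dist_eq0 => /eqP-> /=; rewrite eqxx.
elim: n u b dn => [|n IHn] u b dn; have [w uw dw] := dist_step dn;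
  rewrite -dn !(swalk_step _ uw) ?dw // addNb.
  by move/eqP: dw; rewrite dist_eq0 => /eqP-> /=; rewrite eqxx.
exact: IHn.
Qed.

(** Signs as booleans turn the product of signs into [(+)]. *)
Definition negative u v : bool := ~~ swalk e sigma (d u v) u v false.

Lemma negative_step u w v : e u w -> d u v = (d w v).+1 ->
  negative u v = neg u w (+) negative w v.
Proof.
move=> uw dw; rewrite /negative (swalk_step _ uw dw).
by case: (neg u w); rewrite //= (swalkN w v false).
Qed.

Lemma negative_xx u : negative u u = false.
Proof. by rewrite /negative dist_xx /= eqxx. Qed.

Lemma negative_edge u v : e u v -> negative u v = neg u v.
Proof.
move=> uv; have duv : d u v = (d v v).+1 by rewrite dist_xx dist_edge.
by rewrite (negative_step uv duv) negative_xx addbF.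
Qed.

Lemma negative_cat u v w : d u w = d u v + d v w ->
  negative u w = negative u v (+) negative v w.
Proof.
case dn: (d u v) => [|n].
  by move/eqP: dn; rewrite dist_eq0 => /eqP->; rewrite negative_xx.
elim: n u dn => [|n IHn] u dn duw; have [z uz dz] := dist_step dn.
  move/eqP: dz; rewrite dist_eq0 => /eqP zv; subst z.
  have du1 : d u w = (d v w).+1 by lia.
  by rewrite (negative_step uz du1) (negative_edge uz).
have dzw : d z w = d z v + d v w.
  by have := dist_triangle z u w; have := dist_triangle v z w; rewrite (dist_edge uz); lia.
have du1 : d u w = (d z w).+1 by lia.
have dv1 : d u v = (d z v).+1 by lia.
rewrite dz in dzw.
by rewrite (negative_step uz du1) (negative_step uz dv1) (IHn z dz dzw) addbA.
Qed.

Lemma negative_sym u v : negative u v = negative v u.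
Proof.
case dn: (d u v) => [|n].
  by move/eqP: dn; rewrite dist_eq0 => /eqP->.
elim: n u dn => [|n IHn] u dn; have [w uw dw] := dist_step dn.
  move/eqP: dw; rewrite dist_eq0 => /eqP wv; subst w.
  have vu : e v u by rewrite edge_sym.
  by rewrite (negative_edge uw) (negative_edge vu) neg_edge_sym.
have wu : e w u by rewrite edge_sym.
have du1 : d u v = (d w v).+1 by rewrite dw.
rewrite (negative_step uw du1) (@negative_cat v w u); last first.
  by rewrite (dist_edge wu) (dist_sym v) (dist_sym v) dn dw addn1.
by rewrite (IHn w dw) (negative_edge wu) (neg_edge_sym uw) addbC.
Qed.

Lemma sdistE u v : sd u v = (if negative u v then - (d u v)%:Z else (d u v)%:Z)%R.
Proof.
by rewrite /sdist /path_sign /negative; case: swalk => /=; rewrite ?mul1r ?mulN1r.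
Qed.

Lemma sdist_dist u v u' v' : sd u v = sd u' v' -> d u v = d u' v'.
Proof. by rewrite !sdistE; do 2 case: (negative _ _); lia. Qed.

(** The common segment from [t] to [w] contributes the same length and the same sign on both
    sides. *)
Lemma sdist_through t x y w : x != t ->
  d x w = d x t + d t w -> d y w = d y t + d t w ->
  (sd x w == sd y w) = (sd t x == sd t y).
Proof.
rewrite -dist_eq0 => xt dx dy; rewrite !sdistE (negative_cat dx) (negative_cat dy) dx dy.
rewrite (dist_sym x t) (dist_sym y t) (negative_sym x t) (negative_sym y t) in xt *.
by do 3 case: (negative _ _); rewrite /=; lia.
Qed.

(** * Resolving sets and the lower bound *)

Lemma resolvingP (W : {set V}) :
  reflect (forall x y, (forall w, w \in W -> sd x w = sd y w) -> x = y)
          (resolving sd W).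
Proof.
apply: (iffP forallP) => [res x y Exy | res x].
  have /forallP/(_ y)/implyP/(_ _)/eqP := res x; apply.
  by apply/forallP=> w; apply/implyP=> /Exy->.
apply/forallP=> y; apply/implyP=> /forallP Exy; apply/eqP/res => w wW.
by have /implyP/(_ wW)/eqP := Exy w.
Qed.

Lemma metric_dim_eq (W0 : {set V}) : resolving sd W0 ->
  (forall W, resolving sd W -> #|W0| <= #|W|) -> metric_dim sd = #|W0|.
Proof.
move=> res0 min0; apply/eqP; rewrite eqn_leq; apply/andP; split.
  have : W0 \in index_enum {set V} by rewrite mem_index_enum.
  rewrite /metric_dim; elim: (index_enum _) => // A r IHr; rewrite big_cons inE.
  case/predU1P=> [<-|/IHr le]; first by rewrite res0 geq_minl.
  by case: ifP => // _; apply: leq_trans (geq_minr _ _) le.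
(* The initial value [#|V|] of the minimum also has to be at least [#|W0|]. *)
apply: (big_ind (leq #|W0|)) => [|m n le1 le2|W]; last exact: min0.
  exact: max_card.
by rewrite leq_min le1.
Qed.

Definition hit (W : {set V}) (t u : V) : bool := [exists w in W, on_leg e t u w].

Lemma hitN W t u w : ~~ hit W t u -> w \in W -> ~~ on_leg e t u w.
Proof. by move=> /existsPn/(_ w) + wW; rewrite wW. Qed.

(** If the signed distances from [t] agreed, no [w] in [W] could separate [x] from [y], because each
    is reached from both through [t]; but disjoint legs share no vertex. *)
Lemma sdist_unhit W t u1 u2 x y : resolving sd W -> terminal e t u1 ->
  terminal e t u2 -> u1 != u2 -> ~~ hit W t u1 -> ~~ hit W t u2 ->
  on_leg e t u1 x -> on_leg e t u2 y -> sd t x != sd t y.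
Proof.
move=> /resolvingP res tu1 tu2 u12 h1 h2 l1 l2; apply/negP=> Exy.
have xy : x = y.
  apply: res => w wW; apply/eqP; rewrite (@sdist_through t) //.
  - by case/andP: l1.
  - exact: dist_through_leg tu1 l1 (hitN h1 wW).
  - exact: dist_through_leg tu2 l2 (hitN h2 wW).
by move: u12; rewrite (on_leg_disjoint tu1 tu2 l1) ?eqxx // xy.
Qed.

Lemma terminal_exterior t u : terminal e t u -> exterior_major e t.
Proof.
move=> tu; rewrite /exterior_major (terminal_major tu) /=.
by apply/card_gt0P; exists u; rewrite inE.
Qed.

Lemma unhit_special W t u1 u2 : resolving sd W -> terminal e t u1 ->
  terminal e t u2 -> u1 != u2 -> ~~ hit W t u1 -> ~~ hit W t u2 -> special e sigma t.
Proof.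
move=> res tu1 tu2 u12 h1 h2; rewrite /special (terminal_exterior tu1) /=.
apply/existsP; exists u1; apply/existsP; exists u2; apply/and4P; split=> //.
apply/forallP=> x; apply/forallP=> y; apply/implyP=> /and3P[l1 l2 _].
exact: sdist_unhit res tu1 tu2 u12 h1 h2 l1 l2.
Qed.

(* Only two signs are available for the first vertices of three legs. *)
Lemma unhit3 W t u1 u2 u3 : resolving sd W ->
  terminal e t u1 -> terminal e t u2 -> terminal e t u3 ->
  u1 != u2 -> u1 != u3 -> u2 != u3 ->
  ~~ hit W t u1 -> ~~ hit W t u2 -> ~~ hit W t u3 -> False.
Proof.
move=> res tu1 tu2 tu3 u12 u13 u23 h1 h2 h3.
have leg1 u : terminal e t u -> exists2 a, d t a = 1 & on_leg e t u a.
  move=> tu; have [a ta bu] := ex_branch (terminal_neq tu).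
  by exists a; rewrite ?dist_edge // (on_legE _ tu ta bu) branch_root.
have [a1 d1 l1] := leg1 _ tu1; have [a2 d2 l2] := leg1 _ tu2.
have [a3 d3 l3] := leg1 _ tu3.
have := sdist_unhit res tu1 tu2 u12 h1 h2 l1 l2.
have := sdist_unhit res tu1 tu3 u13 h1 h3 l1 l3.
have := sdist_unhit res tu2 tu3 u23 h2 h3 l2 l3.
by rewrite !sdistE d1 d2 d3; do 3 case: (negative _ _).
Qed.

Lemma card_unhit W t : resolving sd W ->
  #|[set u | terminal e t u && ~~ hit W t u]| <= 1 + special e sigma t.
Proof.
move=> res; set N := [set u | _]; rewrite leqNgt; apply/negP=> ltN.
have [u1 [u2 [N1 N2 u12]]] : exists u1 u2, [/\ u1 \in N, u2 \in N & u1 != u2].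
  by have /card_gt1P := leq_ltn_trans (leq_addr _ 1) ltN.
move: (N1) (N2); rewrite !inE => /andP[t1 h1] /andP[t2 h2].
rewrite (unhit_special res t1 t2 u12 h1 h2) in ltN.
have /card_gt2P[v1 [v2 [v3 [[]]]]] := ltN; rewrite !inE.
move=> /andP[tv1 k1] /andP[tv2 k2] /andP[tv3 k3] [v12 v23 v31].
by rewrite eq_sym in v31; apply: (@unhit3 W t v1 v2 v3).
Qed.

(** Legs are pairwise disjoint over all [t], so sending [w] to the leg containing it maps [W] onto
    the hit legs; the default [(w, w)] serves vertices on no leg. *)
Lemma sum_card_hit W : \sum_t #|[set u | terminal e t u && hit W t u]| <= #|W|.
Proof.
under eq_bigr do rewrite -sum1_card; rewrite pair_big_dep /= sum1_card.
pose legOf w := odflt (w, w) [pick p : V * V | terminal e p.1 p.2 && on_leg e p.1 p.2 w].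
apply: leq_trans (leq_imset_card legOf _); apply/subset_leq_card/subsetP=> -[t u].
move=> tuP; have : u \in [set u0 | terminal e t u0 && hit W t u0] by exact: tuP.
rewrite inE => /andP[tu /existsP[w /andP[wW lw]]].
apply/imsetP; exists w => //; rewrite /legOf; case: pickP => [[t' u'] /= /andP[tu' lw']|/(_ (t, u))].
  have uu' := on_leg_disjoint tu tu' lw lw'; subst u'.
  by rewrite (terminal_inj tu tu').
by rewrite /= tu lw.
Qed.

Lemma sum_special : \sum_t (special e sigma t : nat) = #|eta e sigma|.
Proof.
by rewrite -sum1_card [RHS]big_mkcond; apply: eq_bigr => t _; rewrite inE; case: special.
Qed.

(** At each [t], the terminal vertices split into hit ones, counted by [W] in total, and at most
    [1 + special e sigma t] others. *)
Lemma resolving_lower W : resolving sd W ->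
  \sum_t (ter e t).-1 <= #|W| + #|eta e sigma|.
Proof.
move=> res; rewrite -sum_special; apply: leq_trans (leq_add (sum_card_hit W) (leqnn _)).
rewrite -big_split /=; apply: leq_sum => t _; have := card_unhit t res.
rewrite /ter -(cardsID [set u | hit W t u] [set u | terminal e t u]).
have -> : [set u | terminal e t u] :&: [set u | hit W t u] =
          [set u | terminal e t u && hit W t u] by apply/setP=> u; rewrite !inE.
have -> : [set u | terminal e t u] :\: [set u | hit W t u] =
          [set u | terminal e t u && ~~ hit W t u].
  by apply/setP=> u; rewrite !inE andbC.
by lia.
Qed.

(** * A small resolving set and the upper bound *)

(** [O] holds the terminal vertices of [t] to be left out of the resolving set. *)
Lemma ex_omitted_legs t : exists O : {set V},
  [/\ O \subset [set u | terminal e t u], #|O| = (0 < ter e t) + special e sigma t &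
    forall u1 u2 x y, u1 \in O -> u2 \in O -> u1 != u2 ->
      on_leg e t u1 x -> on_leg e t u2 y -> d t x = d t y -> sd t x != sd t y].
Proof.
have [spec|nspec] := boolP (special e sigma t).
  case/andP: (spec) => /andP[_ ->] /existsP[u1 /existsP[u2 /and4P[tu1 tu2 u12 /forallP opp]]].
  exists [set u1; u2]; split.
  - by apply/subsetP=> u; rewrite !inE => /orP[]/eqP->.
  - by rewrite cards2 u12.
  move=> v1 v2 x y; rewrite !inE => /orP[]/eqP-> /orP[]/eqP->; rewrite ?eqxx // => _ l1 l2 Exy.
    by have /forallP/(_ y) := opp x; rewrite l1 l2 Exy eqxx.
  by have /forallP/(_ x) := opp y; rewrite l1 l2 Exy eqxx eq_sym.
have [ter0|] := posnP (ter e t).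
  by exists set0; split; rewrite ?sub0set ?cards0 ?ter0 // => u1 u2 x y; rewrite inE.
case/card_gt0P=> u; rewrite inE => tu; exists [set u]; split.
- by rewrite sub1set inE.
- by rewrite cards1.
by move=> u1 u2 x y; rewrite !inE => /eqP-> /eqP->; rewrite eqxx.
Qed.

(** By parity [x] and [y] are at even distance, so their path has a midpoint [m]. A vertex of [W] in
    the branch towards one of them would be strictly closer to that one. *)
Lemma ex_equidistant_center (W : {set V}) x y w0 : w0 \in W -> x != y ->
  (forall w, w \in W -> d x w = d y w) ->
  exists m a b, [/\ e m a, e m b, branch m a x, branch m b y &
    [/\ a != b, d m x = d m y, (forall w, w \in W -> ~~ branch m a w) &
      (forall w, w \in W -> ~~ branch m b w)]].
Proof.
move=> w0W xy Exy; have oddxy := odd_dist x y w0; rewrite (Exy w0) // addbb in oddxy.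
have dxy : d x y = (d x y)./2 + (d x y)./2 by lia.
have [|m [xm my]] := @dist_between x y (d x y)./2; first by lia.
have d0 : d x y != 0 by rewrite dist_eq0.
have [|a ma ba] := @ex_branch m x; first by rewrite -dist_eq0; lia.
have [|b mb bb] := @ex_branch m y; first by rewrite -dist_eq0 dist_sym; lia.
have mid : d x m = d y m by rewrite (dist_sym y m); lia.
have nax : ~~ branch m a y.
  apply/negP=> bay; have := dist_triangle a x y.
  have := branchE ma ba; have := branchE ma bay.
  by rewrite (dist_sym a y) (dist_sym y m); lia.
have nby : ~~ branch m b x.
  by apply: contraNN nax => bx; rewrite (branch_uniq ma mb ba bx).
exists m, a, b; split=> //; split.
- by apply: contraNneq nax => ->.
- by rewrite !(dist_sym m).
- move=> w wW; apply/negP=> bw.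
  have nbw : ~~ branch m b w.
    by apply: contraNN nby => bw'; rewrite -(branch_uniq ma mb bw bw').
  have := dist_through mb bb nbw; have := dist_triangle a x w.
  have := branchE ma ba; have := branchE ma bw; rewrite -(Exy w wW).
  by rewrite (dist_sym a w) (dist_sym m w); lia.
move=> w wW; apply/negP=> bw.
have naw : ~~ branch m a w.
  by apply: contraNN nax => bw'; rewrite (branch_uniq ma mb bw' bw).
have := dist_through ma ba naw; have := dist_triangle b y w.
have := branchE mb bb; have := branchE mb bw; rewrite (Exy w wW).
by rewrite (dist_sym b w) (dist_sym m w); lia.
Qed.

Lemma ex_small_resolving : ~ is_path_graph e ->
  (forall t, t \in eta e sigma -> ter e t != 2) ->
  exists2 W, resolving sd W & #|W| + #|eta e sigma| <= \sum_t (ter e t).-1.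
Proof.
move=> notpath Hter; have [O OP] := fin_all_exists ex_omitted_legs.
pose T t := [set u | terminal e t u].
pose W := \bigcup_t (T t :\: O t).
have W_terminal t u : terminal e t u -> u \notin O t -> u \in W.
  by move=> tu uO; apply/bigcupP; exists t => //; rewrite !inE uO.
have W_leaf w : w \in W -> leaf e w.
  by case/bigcupP=> t _; rewrite !inE => /andP[_ /terminal_leaf].
have W_card t : #|T t :\: O t| + special e sigma t = (ter e t).-1.
  have [/setIidPr OT cardO _] := OP t.
  have := cardsD (T t) (O t); rewrite OT cardO -/(ter e t) => ->.
  have := subset_leq_card (introT setIidPr OT); rewrite cardO -/(ter e t).
  have [/andP[/andP[_ ter0] _] | _] := boolP (special e sigma t); last by case: (ter e t) => //= n; lia.
  by rewrite ter0; lia.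
(* Here [ter e t != 2] enters: a special vertex with more than one leg has at least three, so one
   survives the omission of two. *)
have W_meets t : 1 < ter e t -> exists2 u, terminal e t u & u \in W.
  move=> ter2; have : 0 < #|T t :\: O t|.
    have := W_card t; have [spec|_] := boolP (special e sigma t); last by lia.
    by have := Hter t; rewrite inE spec => /(_ isT); lia.
  case/card_gt0P=> u; rewrite !inE => /andP[uO tu]; exists u => //.
  exact: W_terminal tu uO.
exists W; last first.
  rewrite -sum_special; under [in leqRHS]eq_bigr do rewrite -W_card.
  rewrite big_split leq_add2r /=.
  apply: (big_ind2 (fun (A : {set V}) n => #|A| <= n)); rewrite ?cards0 // => A m B n lem len.
  by apply: leq_trans (leq_add lem len); rewrite cardsU leq_subr.
have [r mr] : exists r, major e r.
  case: (boolP [exists r, major e r]) => [/existsP //|/existsPn nomaj].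
  by case: notpath; apply: no_major_path.
have [t0 /W_meets[w0 _ w0W]] := ex_ter_gt1 mr.
apply/resolvingP=> x y Exy; apply/eqP/negPn/negP=> xy.
have [m [a [b [ma mb bx by_ [ab mid naW nbW]]]]] :=
  ex_equidistant_center w0W xy (fun w wW => sdist_dist (Exy w wW)).
(* The leaf [w0] cannot be [m], which has neighbours [a] and [b]; the direction of [w0] then
   supplies the third neighbour that makes [m] major. *)
have w0m : w0 != m.
  apply: contraNneq ab => w0m; have := W_leaf _ w0W; rewrite w0m => leafm.
  by rewrite (leaf_uniq leafm ma mb).
have [c mc bc] := ex_branch w0m.
have mm : major e m.
  apply: (major3 ma mb mc ab).
    by apply/eqP=> ac; have := naW _ w0W; rewrite ac bc.
  by apply/eqP=> ac; have := nbW _ w0W; rewrite ac bc.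
(* A major vertex in a branch avoiding [W] would bring a terminal vertex in [W] into it; so the
   branch is a leg of [m], and its end was omitted. *)
have nomaj f : e m f -> (forall w, w \in W -> ~~ branch m f w) ->
    exists2 u, u \in O m & terminal e m u /\ branch m f u.
  move=> mf nfW; have [|u tu bu] := branch_terminal mm mf.
    move=> z bz; apply/negP=> mz; have [t bt /W_meets[u tu uW]] := far_major mf bz mz.
    by have := nfW _ uW; rewrite (branch_ter mm mf bt tu).
  exists u => //; apply/negPn/negP=> uO.
  by have := nfW _ (W_terminal _ _ tu uO); rewrite bu.
have [u uO [tu bu]] := nomaj a ma naW; have [v vO [tv bv]] := nomaj b mb nbW.
have uv : u != v by apply: contraNneq ab => uv; rewrite uv in bu; rewrite (branch_uniq ma mb bu bv).
have [_ _ /(_ u v x y uO vO uv)] := OP m.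
rewrite (on_legE x tu ma bu) (on_legE y tv mb bv) => /(_ bx by_ mid) /negP; apply.
(* Since [w0] lies outside both legs, agreement at [w0] means agreement at [m], against the choice
   of [O m]. *)
rewrite -(@sdist_through m x y w0) ?Exy //.
- exact: branch_neq bx.
- exact: dist_through ma bx (naW _ w0W).
exact: dist_through mb by_ (nbW _ w0W).
Qed.

Lemma dimS_add_eta : ~ is_path_graph e ->
  (forall t, t \in eta e sigma -> ter e t != 2) ->
  dimS e sigma + #|eta e sigma| = \sum_t (ter e t).-1.
Proof.
move=> notpath Hter; have [W resW leW] := ex_small_resolving notpath Hter.
rewrite /dimS (metric_dim_eq resW) => [|W' /resolving_lower]; last by lia.
by apply/eqP; rewrite eqn_leq leW resolving_lower.
Qed.

End Tree.

(** * The unsigned tree as the constant signature 1 *)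

Section UnsignedTree.

Variables (V : finType) (e : rel V).
Hypothesis Htree : is_tree e.

Local Notation pos := (fun _ _ : V => 1%R : int).

Lemma swalk_pos n u v : swalk e pos n u v false = walk e n u v.
Proof.
elim: n u => [|n IHn] u /=; first by rewrite andbT.
by apply: eq_existsb => w; rewrite -IHn.
Qed.

Lemma sdist_pos u v : sdist e pos u v = udist e u v.
Proof. by rewrite /sdist /path_sign swalk_pos (walk_dist Htree) mul1r. Qed.

(** The first vertices of any two legs at [t] both have signed distance 1 from [t]. *)
Lemma eta_pos : eta e pos = set0.
Proof.
apply/setP=> t; rewrite !inE; apply/negP=> /andP[_ /existsP[u1 /existsP[u2]]].
case/and4P=> tu1 tu2 u12 /forallP opp.
have [a ta bu] := ex_branch Htree (terminal_neq tu1).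
have [b tb bv] := ex_branch Htree (terminal_neq tu2).
have /forallP/(_ b) := opp a.
rewrite (on_legE Htree _ tu1 ta bu) (on_legE Htree _ tu2 tb bv) !sdist_pos /udist.
by rewrite !(branch_root Htree) // !(dist_edge Htree).
Qed.

Lemma dimT_pos : dimT e = dimS e pos.
Proof.
apply: eq_bigl => W; apply: eq_forallb => x; apply: eq_forallb => y.
by congr (_ ==> _); apply: eq_forallb => w; rewrite !sdist_pos.
Qed.

Lemma dimT_eq : ~ is_path_graph e -> dimT e = \sum_t (ter e t).-1.
Proof.
move=> notpath; have := @dimS_add_eta V e Htree pos _ notpath.
by rewrite eta_pos cards0 addn0 dimT_pos; apply=> [u v _|t]; rewrite ?inE //; split; [|left].
Qed.

End UnsignedTree.

Theorem theorem4p3 (V : finType) (e : rel V) (sigma : V -> V -> int)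
  (Htree : is_tree e) (Hsig : is_signature e sigma)
  (Hnotpath : ~ is_path_graph e)
  (Hter : forall t : V, t \in eta e sigma -> ter e t != 2) :
  Posz (dimS e sigma) = (Posz (dimT e) - Posz #|eta e sigma|)%R
  /\ mdd e sigma = Posz #|eta e sigma|.
Proof.
have := dimS_add_eta Htree Hsig Hnotpath Hter; rewrite -(dimT_eq Htree Hnotpath).
by rewrite /mdd; lia.
Qed.
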